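(* For any directed cycle $C_n$ with vertex set $V$ and any initial configuration $\mathbf{c}_0\in\mathbb{N}^n$, if $|\mathbf{c}_0|\ge n$, then $V\in\mathrm{Sp}(C_n,\mathbf{c}_0)$ (i.e. $\sigma_t=V$ for some time $t$), and so $\mathcal{A}(C_n,\mathbf{c}_0)$ is contractible.
   Context: $\mathbb{N}$ includes $0$. $C_n$ is the directed cycle with vertices $V=\{v_1,\dots,v_n\}$ and edges $(v_i,v_{i+1})$, indices modulo $n$; every vertex has out-degree $1$ and there are no sinks. A configuration is a vector $\mathbf{c}\in\mathbb{N}^n$, where $\mathbf{c}(v_i)$ is the number of grains on $v_i$; $|\mathbf{c}|$ is the sum of its entries. Parallel-firing sandpile dynamics started from $\mathbf{c}_0$: at each time $t=0,1,2,\dots$ the firing set $\sigma_t$ is the set of vertices $v_i$ with $\mathbf{c}_t(v_i)\ge 1$; all of these fire simultaneously, each sending one grain to its out-neighbour, so that $\mathbf{c}_{t+1}(v_i)=\mathbf{c}_t(v_i)-[v_i\in\sigma_t]+[v_{i-1}\in\sigma_t]$ (where $[\cdot]$ is $1$ if the condition holds and $0$ otherwise). $\mathrm{Sp}(C_n,\mathbf{c}_0)=\{(\mathbf{c}_t,\sigma_t)\}_{t\in\mathbb{N}}$, and $\sigma\in\mathrm{Sp}(C_n,\mathbf{c}_0)$ means $\sigma=\sigma_t$ for some $t$. The avalanche complex $\mathcal{A}(C_n,\mathbf{c}_0)$ is the simplicial complex generated by the firing sets, i.e. the simplices are all nonempty subsets of the sets $\sigma_t$, $t\ge 0$ (vertices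 that never fire are not vertices of the complex). *)

(* Defs.v *)
From mathcomp Require Import all_boot all_order all_algebra.
From mathcomp Require Import all_classical all_reals topology normedtype.
Import Order.TTheory GRing.Theory Num.Theory.
Import numFieldNormedType.Exports.

Set Implicit Arguments.
Unset Strict Implicit.
Unset Printing Implicit Defensive.

Local Open Scope classical_set_scope.
Local Open Scope ring_scope.

(** Parallel-firing sandpile on the directed cycle [C_n]: the vertices are the
    elements of ['I_n] and the edges are [(v, ordS v)], so the only in-neighbour
    of [v] is [ord_pred v] (for [n = 1], the only edge is a loop). *)

Definition config (n : nat) := {ffun 'I_n -> nat}.

Definition grains (n : nat) (c : config n) : nat := (\sum_(v < n) c v)%N.

Definition firing_set (n : nat) (c : config n) : {set 'I_n} :=
  [set v | (1 <= c v)%N]%SET.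

(* The truncated subtraction is exact: [v] fires only if [1 <= c v]. *)
Definition fire (n : nat) (c : config n) : config n :=
  [ffun v => (c v - (v \in firing_set c) + (ord_pred v \in firing_set c))%N].

Definition config_at (n : nat) (c0 : config n) (t : nat) : config n :=
  iter t (@fire n) c0.

Definition sandpile (n : nat) (c0 : config n) (t : nat) :
    config n * {set 'I_n} :=
  (config_at c0 t, firing_set (config_at c0 t)).

Definition in_sandpile (n : nat) (s : {set 'I_n}) (c0 : config n) : Prop :=
  exists t : nat, s = (sandpile c0 t).2.

(** Abstract simplicial complexes are given by their nonempty simplices. *)

Definition generated_complex (n : nat) (F : set {set 'I_n}) :
    set {set 'I_n} :=
  [set s | s != finset.set0 /\ exists2 f, F f & s \subset f].

Definition avalanche_complex (n : nat) (c0 : config n) : set {set 'I_n} :=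
  generated_complex [set s | in_sandpile s c0].

(** Points of the realization are given by barycentric coordinates; the
    topology is the one induced by [R^n]. *)
Definition realization (R : realType) (n : nat) (K : set {set 'I_n}) :
    set 'rV[R]_n :=
  [set x : 'rV[R]_n | [/\ forall v, 0 <= x ord0 v,
               \sum_(v < n) x ord0 v = 1
             & K [set v | x ord0 v != 0]%SET]].
Arguments realization R {n} K.

(** The subspace [A] is contractible: its identity map is homotopic, within
    [A], to a constant map (in particular [A] is nonempty). *)
Definition contractible (R : realType) (T : topologicalType) (A : set T) :
    Prop :=
  exists (a : T) (H : T * R -> T),
    [/\ A a,
        {within A `*` `[0, 1], continuous H},
        forall x (s : R), A x -> 0 <= s <= 1 -> A (H (x, s)),
        forall x, A x -> H (x, 0) = x
      & forall x, A x -> H (x, 1) = a].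

(* Main.v *)
Require Import Defs.
From mathcomp Require Import all_boot all_order all_algebra.
From mathcomp Require Import all_classical all_reals topology normedtype.
Import numFieldNormedType.Exports.
From mathcomp Require Import zify.
Import Order.TTheory GRing.Theory Num.Theory.

(** The key is to follow empty vertices backwards in time.  A vertex [v] is
    empty at time [t + 1] only if at time [t] its in-neighbour was empty and [v]
    itself held at most one grain ([fire_eq0]).  If some vertex were empty at
    time [n], its emptiness would therefore trace back, one step around the
    cycle per unit of time, through all [n] vertices: every vertex held at most
    one grain at some time before [n].  Holding at most one grain is a property
    that a vertex never loses ([config_at_le1]), so at time [n] every vertex
    would hold at most one grain and one of them none.  That makes fewer than
    [n] grains, while firing conserves the number of grains ([grains_config_at]),
    which is at least [n].  Hence all vertices fire at time [n].

    Since [V] is then a simplex, the complex is the full simplex on [V]; its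
    realization is convex, and a straight-line homotopy contracts it to a
    vertex. *)

Section Sandpile.
Local Open Scope nat_scope.
Variable n : nat.
Implicit Type c : config n.

Lemma fireE c v :
  fire c v = c v - (1 <= c v) + (1 <= c (ord_pred v)).
Proof. by rewrite ffunE !inE. Qed.

Lemma grains_fire c : grains (fire c) = grains c.
Proof.
rewrite /grains.
under eq_bigr => v _ do rewrite fireE.
rewrite big_split /=.
(* Grains received by the out-neighbours are the grains sent, reindexed. *)
rewrite -[X in _ + X](reindex (@ord_pred n) (P := predT)
  (F := fun v => nat_of_bool (1 <= c v))) /=; last first.
  exact/onW_bij/ord_pred_bij.
by rewrite -big_split /=; apply: eq_bigr => v _; lia.
Qed.

Lemma grains_config_at c t : grains (config_at c t) = grains c.
Proof. by elim: t => //= t IHt; rewrite grains_fire. Qed.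

Lemma fire_eq0 c v : fire c v = 0 -> c (ord_pred v) = 0 /\ c v <= 1.
Proof. by rewrite fireE; lia. Qed.

(** A vertex with one grain fires it and receives at most one; an empty one
    only receives. *)
Lemma fire_le1 c v : c v <= 1 -> fire c v <= 1.
Proof. by rewrite fireE; lia. Qed.

Lemma config_at_le1 c v s t :
  s <= t -> config_at c s v <= 1 -> config_at c t v <= 1.
Proof.
move=> /subnK <- c_le1; elim: (t - s) => // d IHd.
exact: fire_le1.
Qed.

Lemma config_at_eq0_trace c v t k : k <= t ->
  config_at c t v = 0 -> config_at c (t - k) (iter k (@ord_pred n) v) = 0.
Proof.
move=> + cv0; elim: k => [|k IHk] lekt; first by rewrite subn0.
have := IHk (ltnW lekt); rewrite -subnSK //=.
by case/fire_eq0.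
Qed.

Lemma val_iter_ord_pred k (v : 'I_n) :
  k <= n -> iter k (@ord_pred n) v = (v + (n - k)) %% n :> nat.
Proof.
have ltvn := ltn_ord v.
elim: k => [|k IHk] lekn /=.
  by rewrite subn0 modnDr modn_small.
rewrite IHk 1?ltnW // -subn1 -addnBA ?modnDml; last by lia.
by rewrite -(modnDr (v + (n - k.+1))); congr (_ %% _); lia.
Qed.

Lemma iter_ord_pred_onto (u v : 'I_n) :
  exists2 k, k < n & u = iter k (@ord_pred n) v.
Proof.
have [ltun ltvn] := (ltn_ord u, ltn_ord v).
have n_gt0 : 0 < n by lia.
have [leuv|ltvu] := leqP u v.
  exists (v - u); first by lia.
  apply: val_inj; rewrite /= val_iter_ord_pred; last by lia.
  have -> : v + (n - (v - u)) = u + n by lia.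
  by rewrite modnDr modn_small.
exists (v + n - u); first by lia.
apply: val_inj; rewrite /= val_iter_ord_pred; last by lia.
have -> : v + (n - (v + n - u)) = u by lia.
by rewrite modn_small.
Qed.

Lemma config_at_gt0 c v : n <= grains c -> 0 < config_at c n v.
Proof.
move=> c_ge; rewrite lt0n; apply/eqP => cv0.
have cn_le1 u : config_at c n u <= 1.
  have [k ltkn ->] := iter_ord_pred_onto u v.
  (* [n - k.+1] is the time just before the trace of the empty vertex [v]
     reaches [u], at which [u] must already be down to one grain. *)
  apply: (@config_at_le1 _ _ (n - k.+1)); first exact: leq_subr.
  have := @config_at_eq0_trace c v n k (ltnW ltkn) cv0.
  by rewrite -subnSK //= => /fire_eq0[].
move: c_ge; rewrite -(grains_config_at c n) leqNgt => /negP; apply.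
rewrite /grains (bigD1 v) //= cv0 add0n.
apply: (@leq_ltn_trans (\sum_(u < n | u != v) 1)); first exact: leq_sum.
rewrite sum1_card cardC1 card_ord.
by have := ltn_ord v; lia.
Qed.

Lemma firing_set_full c :
  n <= grains c -> firing_set (config_at c n) = [set: 'I_n]%SET.
Proof.
by move=> c_ge; apply/setP => v; rewrite !inE config_at_gt0.
Qed.

End Sandpile.

Section Contractible.
Local Open Scope classical_set_scope.
Local Open Scope ring_scope.

Lemma star_shaped_contractible (R : realType) (V : normedModType R)
    (A : set V) (a : V) :
  A a ->
  (forall x (s : R), A x -> 0 <= s <= 1 -> A ((1 - s) *: x + s *: a)) ->
  contractible R A.
Proof.
move=> Aa starA; exists a, (fun xs => (1 - xs.2) *: xs.1 + xs.2 *: a).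
split => //= [|x _|x _]; last 2 first.
- by rewrite subr0 scale1r scale0r addr0.
- by rewrite subrr scale0r scale1r add0r.
apply: continuous_subspaceT => -[x s].
apply: cvgD; apply: cvgZ; [|exact: cvg_fst|exact: cvg_snd|exact: cvg_cst].
by apply: cvgB; [exact: cvg_cst|exact: cvg_snd].
Qed.

Variables (R : realType) (n : nat).
Implicit Types (K : set {set 'I_n}) (x : 'rV[R]_n).

(** As the coordinates of a point sum to 1, its support is never empty. *)
Lemma realization_full K :
  (forall s, s != finset.set0 -> K s) ->
  realization R K =
  [set x | (forall v, 0 <= x ord0 v) /\ \sum_(v < n) x ord0 v = 1].
Proof.
move=> Kfull; apply/seteqP; split => x /= [] // x_ge0 x_sum1.
split=> //; apply: Kfull; apply/eqP => supp0.
have /eqP := x_sum1; rewrite big1 ?[0 == 1]eq_sym ?oner_eq0 // => v _.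
by apply/eqP/negPn/negP => xv; have := finset.in_set0 v; rewrite -supp0 inE xv.
Qed.

Lemma contractible_full_realization K : (0 < n)%N ->
  (forall s, s != finset.set0 -> K s) -> contractible R (realization R K).
Proof.
move=> n_gt0 Kfull; rewrite realization_full //.
pose i := Ordinal n_gt0.
apply: (@star_shaped_contractible R 'rV[R]_n _ (delta_mx ord0 i)).
  split=> [v|]; first by rewrite mxE ler0n.
  rewrite (bigD1 i) //= mxE !eqxx big1 ?addr0 // => v /negPf v_neq_i.
  by rewrite mxE v_neq_i andbF.
move=> x s [x_ge0 x_sum1] /andP[s_ge0 s_le1]; split=> [v|].
  by rewrite !mxE addr_ge0 // mulr_ge0 ?ler0n ?subr_ge0.
under eq_bigr => v _ do rewrite !mxE.
rewrite big_split /= -!mulr_sumr x_sum1 (bigD1 i) //= big1.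
  by rewrite addr0 !mulr1 subrK.
by move=> v /negPf ->.
Qed.

End Contractible.

Theorem proposition3p14 (R : realType) (n : nat) (n_gt0 : (0 < n)%N)
    (c0 : config n) (c0_ge : (n <= grains c0)%N) :
  in_sandpile [set: 'I_n]%SET c0
  /\ contractible R (realization R (avalanche_complex c0)).
Proof.
have V_fires : in_sandpile [set: 'I_n]%SET c0.
  by exists n; rewrite /= firing_set_full.
split=> //; apply: contractible_full_realization => // s s_neq0.
by split=> //; exists [set: 'I_n]%SET; rewrite ?finset.subsetT.
Qed.
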